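(* If $G$ is a finite simple connected claw-free graph of order at least six, then $OD'^-(G)=1$.
   Context: A graph is claw-free if it has no induced subgraph isomorphic to $K_{1,3}$. Write $[k]=\{1,\ldots,k\}$. An orientation of a graph $G$ is a digraph $\overrightarrow{G}$ obtained from $G$ by replacing each edge $xy$ with exactly one of the arcs $\overrightarrow{xy}$, $\overrightarrow{yx}$. Automorphisms of a digraph preserve arcs together with their directions. An arc colouring with colours from $[k]$ (no properness required) is distinguishing if the only automorphism of the digraph preserving the colours of all arcs is the identity; the distinguishing index $D'(\overrightarrow{G})$ is the least integer $k\ge1$ for which a distinguishing arc colouring with colours from $[k]$ exists. Define $OD'^-(G)=\min D'(\overrightarrow{G})$ over all orientations $\overrightarrow{G}$ of $G$. An orientation is rigid if its only automorphism is the identity; thus $OD'^-(G)=1$ precisely when $G$ admits a rigid orientation. *)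

(* Defs.v *)
(* A finite simple graph is a symmetric irreflexive relation [e : rel T] on
   [T : finType]; a digraph is an arbitrary relation [d : rel T].            *)
From mathcomp Require Import all_boot fingroup perm.

Set Implicit Arguments.
Unset Strict Implicit.
Unset Printing Implicit Defensive.

Definition induced_copy (S T : finType) (h : rel S) (e : rel T) : Prop :=
  exists2 f : S -> T, injective f & forall i j, e (f i) (f j) = h i j.

(* The centre is [ord0]. *)
Definition K13 : rel 'I_4 := fun i j => (i == ord0) (+) (j == ord0).

Definition claw_free (T : finType) (e : rel T) : Prop := ~ induced_copy K13 e.

Definition connected_graph (T : finType) (e : rel T) : Prop :=
  forall x y, connect e x y.

Definition orientation (T : finType) (e d : rel T) : Prop :=
  (forall x y, d x y -> e x y) /\ (forall x y, e x y -> d x y (+) d y x).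

Definition automorphism (T : finType) (d : rel T) (s : {perm T}) : Prop :=
  forall x y, d (s x) (s y) = d x y.

(* [c x y] is the colour of the arc from [x] to [y]; the values of [c] on
   pairs that are not arcs are never used.                                   *)
Definition preserves_colours (T : finType) (C : Type) (d : rel T)
    (c : T -> T -> C) (s : {perm T}) : Prop :=
  forall x y, d x y -> c (s x) (s y) = c x y.

Definition distinguishing (T : finType) (C : Type) (d : rel T)
    (c : T -> T -> C) : Prop :=
  forall s : {perm T},
    automorphism d s -> preserves_colours d c s -> s = 1%g.

Definition is_least (P : nat -> Prop) (k : nat) : Prop :=
  P k /\ forall j, P j -> k <= j.

Lemma is_least_unique (P : nat -> Prop) (k l : nat) :
  is_least P k -> is_least P l -> k = l.
Proof.
by case=> Pk mink [Pl minl]; apply/eqP; rewrite eqn_leq mink ?minl.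
Qed.

(* The invariants D' and OD'^- are given by their graphs, since D' has no
   value when no colouring is distinguishing (two isolated vertices).
   ['I_k] stands for the set of colours [k] = {1, ..., k}.                   *)
Definition distinguishing_index_is (T : finType) (d : rel T) (k : nat) : Prop :=
  is_least
    (fun j => 0 < j /\ exists c : T -> T -> 'I_j, distinguishing d c) k.

Definition min_oriented_distinguishing_index_is (T : finType) (e : rel T)
    (m : nat) : Prop :=
  is_least
    (fun k => exists2 d : rel T, orientation e d & distinguishing_index_is d k)
    m.

(* Main.v *)
Require Import Defs.
From mathcomp Require Import all_boot fingroup perm.

(** The orientation comes from a depth-first search tree, that is, a rooted
    spanning tree in which adjacent vertices are always comparable for the
    ancestor order [le]; every edge is directed away from the root.  Such a
    digraph determines [le], since [le] is reachability, so its automorphisms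
    are automorphisms of the rooted tree.  An automorphism that fixes the
    strict ancestors of [x] sends [x] to a sibling of [x] that has the same
    neighbours among these ancestors and a subtree of the same size.  If no two
    distinct vertices are related in this way (no [twins]), induction from the
    root shows that the automorphism is the identity
    ([rigid_of_no_twins]).

    It remains to find a depth-first tree without twins.  Any one will do as a
    first attempt.  If it has twins [u] and [w], then claw-freeness, used from
    the parent of [u] up to the root [r], shows that every strict ancestor of
    [u] is adjacent to both [u] and [w] ([ancestors_adjacent]).  Hence
    [u] followed by its ancestors, in order from [r], is again a path of the
    graph.  A path can always be completed to a depth-first tree that starts
    along it ([normal_tree_span]), and the completed tree has no twins
    ([regrow_no_twins]).  Indeed suppose that [x] and [y] are twins in it; they
    are both adjacent to the new root [u].
    - They are incomparable, so the path does not contain both.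
    - If [x] is on the path and [y] is not, then [w] and its whole old subtree
      lie below [x], whereas only proper descendants of [u] lie below [y];
      since the old subtrees of [u] and [w] had the same size, the new
      subtrees of [x] and [y] differ in size.
    - If neither is on the path, both are old descendants of [u].  If [r] is an
      ancestor of both, then [r] with [x], [y], [w] is a claw; otherwise [u]
      with [r], [x], [y] is one. *)

Set Implicit Arguments.
Unset Strict Implicit.
Unset Printing Implicit Defensive.

(** * Normal trees *)

Definition outside (T : finType) (e : rel T) (A : {set T}) : rel T :=
  fun x y => [&& e x y, x \notin A & y \notin A].

(** [le] is the ancestor order of a tree with root [r] and vertex set [A],
    false off [A].  The tree edges are not recorded: [nt_step] says that
    a vertex is joined to its descendants by descending paths of [e], and
    forces each vertex to be adjacent to its parent.  [nt_edge] is the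
    depth-first property.  [nt_sep] is what lets a partial tree grow: the
    vertices of the tree next to a given component of its complement lie on
    one branch, so the component can be hung below the lowest of them. *)
Record normal_tree (T : finType) (e : rel T) (r : T) (A : {set T})
    (le : rel T) : Prop := NormalTree {
  nt_dom : forall a b, le a b -> (a \in A) && (b \in A);
  nt_root_in : r \in A;
  nt_root : forall a, a \in A -> le r a;
  nt_refl : forall a, a \in A -> le a a;
  nt_anti : antisymmetric le;
  nt_trans : transitive le;
  nt_chain : forall a b c, le a c -> le b c -> le a b || le b a;
  nt_step : forall a b, le a b -> a != b ->
    exists z, [&& e a z, le a z & le z b];
  nt_edge : forall a b, a \in A -> b \in A -> e a b -> le a b || le b a;
  nt_sep : forall x y a b, x \notin A -> connect (outside e A) x y ->
    a \in A -> b \in A -> e x a -> e y b -> le a b || le b a }.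

Definition lt (T : finType) (le : rel T) (a b : T) := le a b && (a != b).

Definition subtree (T : finType) (le : rel T) (a : T) := [set b | le a b].

Definition siblings (T : finType) (le : rel T) (x y : T) :=
  (x != y) && [forall a, lt le a x == lt le a y].

(** An automorphism of the tree that fixes the ancestors of [x] can move it only
    to a twin.  Equality of sizes stands in for isomorphism of the subtrees: it
    is enough to exclude twins after regrowing the tree. *)
Definition twins (T : finType) (e le : rel T) (x y : T) :=
  [&& siblings le x y, [forall a, lt le a x ==> (e a x == e a y)]
    & #|subtree le x| == #|subtree le y|].

Definition downward (T : finType) (e le : rel T) : rel T :=
  fun x y => e x y && le x y.

Lemma siblingsP (T : finType) (le : rel T) (x y : T) :
  reflect (x != y /\ forall a, lt le a x = lt le a y) (siblings le x y).
Proof.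
apply: (iffP andP) => -[neq anc]; split=> //.
  by move=> a; apply/eqP/(forallP anc).
by apply/forallP=> a; rewrite anc.
Qed.

Lemma twinsP (T : finType) (e le : rel T) (x y : T) :
  reflect [/\ siblings le x y, forall a, lt le a x -> e a x = e a y
            & #|subtree le x| = #|subtree le y|]
          (twins e le x y).
Proof.
apply: (iffP and3P) => -[sib adj /eqP eqD]; split=> //.
  by move=> a ax; have := forallP adj a; rewrite ax => /eqP.
by apply/forallP=> a; apply/implyP=> /adj ->.
Qed.

Lemma claw_free_nbrs (T : finType) (e : rel T) (c x y z : T) :
  symmetric e -> irreflexive e -> claw_free e ->
  e c x -> e c y -> e c z -> x != y -> x != z -> y != z ->
  [|| e x y, e x z | e y z].
Proof.
move=> e_sym e_irr cf cx cy cz xy xz yz.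
have ne a b : e a b -> a != b by apply: contraTneq => ->; rewrite e_irr.
case: (boolP [|| _, _ | _]) => //; rewrite !negb_or => /and3P[nxy nxz nyz].
have uq : uniq [:: c; x; y; z].
  by rewrite /= !inE !negb_or xy xz yz (ne _ _ cx) (ne _ _ cy) (ne _ _ cz).
case: cf; exists (fun i : 'I_4 => nth c [:: c; x; y; z] i).
  by move=> i j /eqP; rewrite nth_uniq // => /eqP/val_inj.
have sym0 a b : ~~ e a b -> e a b = false /\ e b a = false.
  by move=> /negbTE ab; rewrite [e b a]e_sym.
have [[? ?] [? ?] [? ?]] := And3 (sym0 _ _ nxy) (sym0 _ _ nxz) (sym0 _ _ nyz).
have E : [/\ e x c, e y c & e z c] by rewrite !(e_sym _ c).
case: E => xc yc zc [i ilt] [j jlt]; rewrite /K13 -!val_eqE /=.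
by case: i ilt => [|[|[|[|]]]]; case: j jlt => [|[|[|[|]]]] //=; rewrite e_irr.
Qed.

Lemma outside_connect (T : finType) (e : rel T) (A : {set T}) x y :
  x \notin A -> connect (outside e A) x y -> y \notin A.
Proof.
move=> xA /connectP[p]; elim/last_ind: p => [|p z _] /= => [_ -> //|].
by rewrite rcons_path last_rcons => /andP[_ /and3P[_ _ zA]] ->.
Qed.

Lemma exit_edge (T : finType) (e : rel T) (A : {set T}) r y :
  connected_graph e -> r \in A -> y \notin A ->
  exists p x, [/\ p \in A, x \notin A & e p x].
Proof.
move=> conn rA; have /connectP[s] := conn r y.
elim: s r rA => [|z s IH] r rA /= => [_ -> /negP //|/andP[rz]].
by have [zA|zA _ _ _] := boolP (z \in A); [apply: IH | exists r, z].
Qed.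

(** The new vertex is a leaf [x] hung below [t], where [t] is the lowest tree
    vertex that has a neighbour in some component of the complement, and [x] is
    such a neighbour.  All neighbours in the tree of this component are
    ancestors of [t], so the remains of the component are next to ancestors of
    [x] only. *)
Lemma normal_tree_grow (T : finType) (e : rel T) r (A : {set T}) le :
  symmetric e -> irreflexive e -> connected_graph e ->
  normal_tree e r A le -> A != setT ->
  exists x le', [/\ x \notin A, normal_tree e r (x |: A) le' &
    forall a b, b \in A -> le' a b = le a b].
Proof.
move=> e_sym e_irr conn [dom rA root rfl anti trans chain step edge sep] AT.
have [y _ yA] : exists2 y, y \in [set: T] & y \notin A.
  by apply/subsetPn; rewrite subTset.
have [p [x0 [pA x0A px0]]] := exit_edge conn rA yA.
have csym : connect_sym (outside e A).
  by apply: sym_connect_sym => a b; rewrite /outside e_sym [X in _ && X]andbC.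
pose B := [set q in A | [exists z, connect (outside e A) x0 z && e z q]].
have pB : p \in B.
  by rewrite inE pA; apply/existsP; exists x0; rewrite connect0 e_sym.
case: (@arg_maxnP _ p [in B] (fun q => #|[set a | le a q]|) pB) => t.
rewrite inE => /andP[tA /existsP[x /andP[x0x xt]]] tmax.
have xA := outside_connect x0A x0x.
(* [t] maximizes the depth among the neighbours of the component of [x0]; as
   these form a chain by [nt_sep], all of them are ancestors of [t]. *)
have le_t z q : connect (outside e A) x0 z -> q \in A -> e z q -> le q t.
  move=> x0z qA zq.
  have qB : q \in B by rewrite inE qA; apply/existsP; exists z; rewrite x0z.
  have xz : connect (outside e A) x z.
    by apply: connect_trans x0z; rewrite csym.
  have /orP[tq|//] := sep _ _ _ _ xA xz tA qA xt zq.
  have sub : [set a | le a t] \subset [set a | le a q].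
    by apply/subsetP=> a; rewrite !inE => /trans; apply.
  have /eqP E : [set a | le a t] == [set a | le a q].
    by rewrite eqEcard sub; apply: tmax.
  by have : q \in [set a | le a t]; [rewrite E inE rfl | rewrite inE].
pose le' a b := le a b || (b == x) && ((a == x) || le a t).
have leA a b : b \in A -> le' a b = le a b.
  move=> bA; rewrite /le'; have -> : (b == x) = false.
    by apply: contraNF xA => /eqP <-.
  by rewrite orbF.
have le'x a : le' a x = (a == x) || le a t.
  rewrite /le' eqxx /=; have -> // : le a x = false.
  by apply: contraNF xA => /dom/andP[].
have domx a b : le' a b -> (a \in x |: A) && (b \in x |: A).
  rewrite !inE => /orP[/dom/andP[-> ->]|/andP[->]]; rewrite ?orbT //=.
  by case/orP=> [->//|/dom/andP[->]]; rewrite orbT.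
have le'A a b : le' a b -> b \in A -> a \in A.
  by move=> ab bA; move: ab; rewrite leA // => /dom/andP[].
exists x, le'; split=> //; split=> //.
- by rewrite !inE rA orbT.
- move=> a /setU1P[->|aA]; last by rewrite leA // root.
  by rewrite le'x root ?orbT.
- move=> a /setU1P[->|aA]; last by rewrite leA // rfl.
  by rewrite le'x eqxx.
- move=> a b /andP[ab ba]; have /andP[] := domx _ _ ab.
  case/setU1P=> [ax|aA] /setU1P[bx|bA]; first by rewrite ax.
  + by move: xA; rewrite -ax (le'A _ _ ab).
  + by move: xA; rewrite -bx (le'A _ _ ba).
  + by apply: anti; rewrite -!leA // ab.
- move=> b a c ab bc; have /andP[_ /setU1P[E|cA]] := domx _ _ bc; last first.
    have bA := le'A _ _ bc cA.
    by move: ab bc; rewrite !leA //; apply: trans.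
  rewrite E in bc *; move: (bc); rewrite le'x.
  case/orP=> [/eqP <- //|bt]; have /andP[bA _] := dom _ _ bt.
  by rewrite le'x (trans _ _ _ _ bt) ?orbT // -leA.
- move=> a b c ac bc; have /andP[_ /setU1P[E|cA]] := domx _ _ bc; last first.
    have [aA bA] := (le'A _ _ ac cA, le'A _ _ bc cA).
    by move: ac bc; rewrite !leA //; apply: chain.
  have /andP[aD _] := domx _ _ ac; have /andP[bD _] := domx _ _ bc.
  move: ac bc; rewrite E !le'x => /predU1P[->|at_] /predU1P[->|bt].
  + by rewrite le'x eqxx.
  + by rewrite !le'x bt !orbT.
  + by rewrite !le'x at_ !orbT.
  + have /andP[aA _] := dom _ _ at_; have /andP[bA _] := dom _ _ bt.
    by rewrite !leA //; apply: chain bt.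
- move=> a b ab neq; have /andP[_ /setU1P[E|bA]] := domx _ _ ab; last first.
    rewrite leA // in ab; have [z /and3P[az laz lzb]] := step _ _ ab neq.
    by exists z; rewrite az /le' laz lzb.
  rewrite E in ab neq *; move: ab; rewrite le'x (negPf neq) /= => at_.
  have [->|nat] := eqVneq a t.
    by exists x; rewrite e_sym xt !le'x rfl ?eqxx ?orbT.
  have [z /and3P[az laz lzt]] := step _ _ at_ nat.
  by exists z; rewrite az le'x lzt orbT /le' laz.
- move=> a b /setU1P[->|aA] /setU1P[->|bA] eab; rewrite ?e_irr // in eab *.
  + by rewrite !le'x (le_t _ _ x0x bA eab) !orbT.
  + by rewrite !le'x (le_t _ _ x0x aA) ?orbT // e_sym.
  + by rewrite !leA // edge.
(* For [nt_sep]: a walk that avoids [x |: A] avoids [A], and if one of its ends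
   is adjacent to [x] then it stays in the component of [x0]. *)
move=> x1 y1 a b; rewrite inE negb_or inE => /andP[_ x1A] c aA bA.
have {}c : connect (outside e A) x1 y1.
  apply: connect_sub c => u v /and3P[uv]; rewrite !inE !negb_or.
  by move=> /andP[_ uA] /andP[_ vA]; apply: connect1; rewrite /outside uv uA.
case/setU1P: aA => [->|aA]; case/setU1P: bA => [->|bA] x1a y1b.
- by rewrite le'x eqxx.
- have x1x0 : connect (outside e A) x0 x1.
    by apply: connect_trans x0x (connect1 _); rewrite /outside e_sym x1a xA.
  by rewrite !le'x (le_t _ _ (connect_trans x1x0 c) bA y1b) !orbT.
- have y1x : connect (outside e A) x y1.
    apply: connect1; rewrite /outside e_sym y1b xA.
    by rewrite (outside_connect x1A c).
  rewrite csym in c.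
  have x0x1 := connect_trans x0x (connect_trans y1x c).
  by rewrite !le'x (le_t _ _ x0x1 aA x1a) !orbT.
by rewrite !leA //; apply: sep c aA bA x1a y1b.
Qed.

(** The last clause also makes [A] closed under ancestors in the new tree,
    because [le] is false off [A]. *)
Lemma normal_tree_span (T : finType) (e : rel T) r (A : {set T}) le :
  symmetric e -> irreflexive e -> connected_graph e ->
  normal_tree e r A le ->
  exists2 le', normal_tree e r setT le' &
    forall a b, b \in A -> le' a b = le a b.
Proof.
move=> e_sym e_irr conn; have [n] := ubnP #|~: A|.
elim: n => // n IH in A le *; rewrite ltnS => An nt.
have [E|AT] := eqVneq A setT; first by exists le; rewrite -?E.
have [x [le1 [xA nt1 E1]]] := normal_tree_grow e_sym e_irr conn nt AT.
have [|le2 nt2 E2] := IH _ _ _ nt1.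
  apply: leq_trans An; apply: proper_card; rewrite properE.
  rewrite setCS subsetUr setCS; apply: contra xA => /subsetP; apply.
  exact: setU11.
by exists le2 => // a b bA; rewrite E2 ?E1 // inE bA orbT.
Qed.

(** For a chain the comparability conditions are void, so any path is a partial
    normal tree and can be the beginning of a spanning one. *)
Lemma normal_tree_chain (T : finType) (e : rel T) r (A : {set T}) (le : rel T) :
  r \in A -> reflexive le -> antisymmetric le -> transitive le ->
  {in A &, total le} -> (forall a, a \in A -> le r a) ->
  (forall a b, a \in A -> b \in A -> lt le a b ->
    exists z, [&& z \in A, e a z, le a z & le z b]) ->
  normal_tree e r A (fun a b => [&& a \in A, b \in A & le a b]).
Proof.
move=> rA rfl anti trans tot root step; split=> //.
- by move=> a b /and3P[-> ->].
- by move=> a aA; rewrite rA aA root.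
- by move=> a ->; rewrite rfl.
- by move=> a b /andP[/and3P[_ _ ab] /and3P[_ _ ba]]; apply: anti; rewrite ab.
- by move=> b a c /and3P[-> _ ab] /and3P[_ -> /(trans _ _ _ ab)].
- by move=> a b c /and3P[aA _ _] /and3P[bA _ _]; rewrite aA bA tot.
- move=> a b /and3P[aA bA ab] neq.
  have [|z /and4P[zA az laz lzb]] := step a b aA bA; first by rewrite /lt ab.
  by exists z; rewrite az aA bA zA laz.
- by move=> a b aA bA _; rewrite aA bA tot.
- by move=> x y a b _ _ aA bA _ _; rewrite aA bA tot.
Qed.

Lemma subtree_proper (T : finType) (e : rel T) r (A : {set T}) le a b :
  normal_tree e r A le -> lt le a b -> #|subtree le b| < #|subtree le a|.
Proof.
move=> nt /andP[ab neq]; have /andP[aA bA] := nt_dom nt ab.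
apply: proper_card; apply/properP; split.
  by apply/subsetP=> c; rewrite !inE; apply: (nt_trans nt).
exists a; rewrite !inE ?(nt_refl nt) //.
by apply: contraNN neq => ba; apply/eqP/(nt_anti nt); rewrite ab.
Qed.

(** Induction along a descending path of [e] from [a] to [b]. *)
Lemma descend_ind (T : finType) (e : rel T) r (A : {set T}) le
    (P : T -> Prop) a b :
  irreflexive e -> normal_tree e r A le ->
  (forall x y, e x y -> le x y -> le y b -> P x -> P y) ->
  le a b -> P a -> P b.
Proof.
move=> e_irr nt Pstep; have [n] := ubnP #|subtree le a|.
elim: n a => // n IH a; rewrite ltnS => an ab Pa.
have [<- //|neq] := eqVneq a b.
have [z /and3P[az laz lzb]] := nt_step nt ab neq.
apply: (IH z) => //; last exact: Pstep Pa.
apply: leq_trans an; apply: (subtree_proper nt); rewrite /lt laz.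
by apply: contraTneq az => ->; rewrite e_irr.
Qed.

(** * Rigidity of the downward orientation *)

Lemma downward_orientation (T : finType) (e : rel T) r le :
  symmetric e -> irreflexive e -> normal_tree e r setT le ->
  orientation e (downward e le).
Proof.
move=> e_sym e_irr nt; split=> x y; first by case/andP.
move=> xy; rewrite /downward [e y x]e_sym xy /=.
have /orP := nt_edge nt (in_setT x) (in_setT y) xy.
have : ~~ (le x y && le y x).
  by apply: contraTN xy => /(nt_anti nt) ->; rewrite e_irr.
by case: (le x y); case: (le y x) => //= _ [].
Qed.

(** By [descend_ind], [le] is reachability along the arcs, so [s] preserves it.
    From the root downwards, once the strict ancestors of [x] are fixed, [x] and
    [s x] have the same ancestors, the same adjacencies to them, and subtrees
    of the same size, matched by [s]: they would be twins if distinct. *)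
Lemma rigid_of_no_twins (T : finType) (e : rel T) r le (s : {perm T}) :
  irreflexive e -> normal_tree e r setT le ->
  (forall x y, ~~ twins e le x y) ->
  automorphism (downward e le) s -> s = 1%g.
Proof.
move=> e_irr nt no_twins.
have mono (p : {perm T}) a b :
    automorphism (downward e le) p -> le a b -> le (p a) (p b).
  move=> aut ab.
  apply: (descend_ind (P := fun z => le (p a) (p z)) e_irr nt _ ab).
    move=> x y xy lexy _ ax; apply: (nt_trans nt) ax _.
    have : downward e le x y by rewrite /downward xy.
    by rewrite -aut => /andP[].
  exact: nt_refl nt _ (in_setT _).
move=> aut; have autV : automorphism (downward e le) s^-1%g.
  by move=> x y; rewrite -aut !permKV.
have le_s a b : le (s a) (s b) = le a b.
  by apply/idP/idP=> [/(mono _ _ _ autV)|/(mono _ _ _ aut) //]; rewrite !permK.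
have lt_s a b : lt le (s a) (s b) = lt le a b.
  by rewrite /lt le_s (inj_eq perm_inj).
apply/permP=> x; rewrite perm1; have [n] := ubnP #|[set a | le a x]|.
elim: n x => // n IH x; rewrite ltnS => xn.
have fixa a : lt le a x -> s a = a.
  move=> ax; apply: IH; apply: leq_trans xn; apply: proper_card.
  have /andP[lax neq] := ax; apply/properP; split.
    by apply/subsetP=> c; rewrite !inE => ca; apply: (nt_trans nt) ca _.
  exists x; rewrite !inE ?(nt_refl nt) ?inE //.
  by apply: contraNN neq => xa; apply/eqP/(nt_anti nt); rewrite lax.
apply/eqP/negPn/negP => neq; case/negP: (no_twins x (s x)); apply/twinsP.
have anc a : lt le a x = lt le a (s x).
  apply/idP/idP=> [ax|asx]; first by rewrite -(fixa a ax) lt_s.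
  have ax : lt le (s^-1%g a) x by rewrite -lt_s permKV.
  by rewrite -{1}(permKV s a) (fixa _ ax).
split; first by apply/siblingsP; split=> //; rewrite eq_sym.
  move=> a ax; have := aut a x; rewrite (fixa _ ax) /downward.
  have := ax; rewrite anc => /andP[-> _].
  by case/andP: ax => -> _; rewrite !andbT.
rewrite -(card_imset _ (@perm_inj _ s)); apply: eq_card => b.
by rewrite -(permKV s b) mem_imset ?inE ?le_s; last exact: perm_inj.
Qed.

(** * Twins in claw-free graphs *)

Definition incomparable (T : finType) (le : rel T) (x y : T) :=
  ~~ le x y && ~~ le y x.

Lemma siblings_incomparable (T : finType) (e : rel T) r le x y :
  normal_tree e r setT le -> siblings le x y -> incomparable le x y.
Proof.
move=> nt /siblingsP[neq anc]; apply/andP; split; apply/negP => xy.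
  by have := anc x; rewrite /lt xy neq eqxx andbF.
by have := anc y; rewrite /lt xy eq_sym neq eqxx andbF.
Qed.

Lemma root_lt_siblings (T : finType) (e : rel T) r le x y :
  normal_tree e r setT le -> siblings le x y -> lt le r x.
Proof.
move=> nt sib; have /andP[nxy _] := siblings_incomparable nt sib.
rewrite /lt (nt_root nt) ?inE //.
by apply: contraNN nxy => /eqP <-; rewrite (nt_root nt) ?inE.
Qed.

Lemma incomparable_nonadjacent (T : finType) (e : rel T) r le x y :
  normal_tree e r setT le -> incomparable le x y -> (x != y) && ~~ e x y.
Proof.
move=> nt /andP[nxy nyx]; apply/andP; split.
  by apply: contraNneq nxy => ->; apply: (nt_refl nt); rewrite inE.
apply/negP => /(nt_edge nt (in_setT x) (in_setT y)).
by rewrite (negPf nxy) (negPf nyx).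
Qed.

(** The parent is adjacent to both siblings.  If an ancestor [a] is not, take a
    neighbour [z] of [a] strictly between [a] and [x]; by induction [z] is
    adjacent to [x] and [y], and then [z] with [a], [x], [y] is a claw. *)
Lemma ancestors_adjacent (T : finType) (e : rel T) r le x y :
  symmetric e -> irreflexive e -> claw_free e -> normal_tree e r setT le ->
  siblings le x y -> (forall a, lt le a x -> e a x = e a y) ->
  forall a, lt le a x -> e a x.
Proof.
move=> e_sym e_irr cf nt sib adj a; have [n] := ubnP #|subtree le a|.
elim: n a => // n IH a; rewrite ltnS => an ax; apply/negPn/negP => nax.
have incxy := siblings_incomparable nt sib.
have /andP[xy nxy] := incomparable_nonadjacent nt incxy.
have /andP[lax neq] := ax.
have [z /and3P[az laz lzx]] := nt_step nt lax neq.
have zx : lt le z x by rewrite /lt lzx; apply: contraNneq nax => <-.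
have ltaz : lt le a z.
  by rewrite /lt laz; apply: contraTneq az => ->; rewrite e_irr.
have ezx : e z x by apply: IH zx; apply: leq_trans (subtree_proper nt ltaz) an.
have ezy : e z y by rewrite -adj.
have ay : lt le a y by have /siblingsP[_ <-] := sib.
have eza : e z a by rewrite e_sym.
have := claw_free_nbrs e_sym e_irr cf eza ezx ezy neq (proj2 (andP ay)) xy.
by rewrite -adj // (negPf nax) (negPf nxy).
Qed.

(** The new tree starts with [u] followed by the old path from [r] to the
    parent of [u]; the two conclusions say that this path is an initial chain
    of it. *)
Lemma reroot_spine (T : finType) (e : rel T) r le u :
  symmetric e -> irreflexive e -> connected_graph e ->
  normal_tree e r setT le ->
  (forall a, lt le a u -> e a u) ->
  exists2 le', normal_tree e u setT le' &
    (forall a b, le' a b -> le b u -> le a u) /\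
    (forall a b, le a u -> le b u -> le' a b || le' b a).
Proof.
move=> e_sym e_irr conn nt adj; pose A := [set a | le a u].
have rfl a : le a a by apply: (nt_refl nt); rewrite inE.
(* The old order, except that [u] comes first. *)
pose up a b := (a == u) || (b != u) && le a b.
have tot : {in A &, total up}.
  move=> a b; rewrite !inE /up => au bu.
  have := nt_chain nt au bu.
  by case: (a == u); case: (b == u).
have ntA : normal_tree e u A (fun a b => [&& a \in A, b \in A & up a b]).
  apply: normal_tree_chain => //.
  - by rewrite inE.
  - by move=> a; rewrite /up rfl andbT orbN.
  - move=> a b; rewrite /up; have [->|au] := eqVneq a u.
      by rewrite orbF => /eqP.
    by case: eqVneq => //= _; apply: nt_anti nt a b.
  - move=> b a c; rewrite /up; have [//|au] := eqVneq a u.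
    by case: eqVneq => //= _ ab /andP[-> /(nt_trans nt ab) ->].
  - by move=> a _; rewrite /up eqxx.
  move=> a b; rewrite !inE /up /lt => au bu.
  case/andP=> /orP[/eqP E|/andP[bnu ab]] neq.
    (* The vertex after [u] on the new path is the old root. *)
    have bnu : b != u by rewrite eq_sym -E.
    have lru : lt le r u.
      rewrite /lt !(nt_root nt) ?inE //; apply: contraNneq bnu => ru.
      by apply/eqP/(nt_anti nt); rewrite bu -ru (nt_root nt) ?inE.
    exists r; rewrite E eqxx e_sym adj // bnu !(nt_root nt) ?inE //.
    by case/andP: lru => -> _; rewrite orbT.
  have [z /and3P[az laz lzb]] := nt_step nt ab neq.
  exists z; rewrite az laz lzb !inE (nt_trans nt lzb bu) bnu.
  have -> : z != u.
    by apply: contraNneq bnu => zu; apply/eqP/(nt_anti nt); rewrite bu -zu.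
  by rewrite !orbT.
have [le' nt' E] := normal_tree_span e_sym e_irr conn ntA.
exists le' => //; split=> a b.
  by move=> le'ab bu; move: le'ab; rewrite E inE // => /andP[]; rewrite inE.
by move=> au bu; rewrite !E ?inE // au bu tot ?inE.
Qed.

(** The tree is regrown from [u] followed by its old ancestors.  Off this path
    no edge of the graph leaves the old subtree of [u], which bounds from above
    the new subtree of a vertex that was strictly below [u] ([smallD]).  The
    old subtree of [w] is connected and misses the path, and each old ancestor
    of [u] is adjacent to [w], which bounds from below the new subtree of such
    an ancestor ([bigD]).  The old subtrees of [u] and [w] have the same size,
    so the two bounds are incompatible with twins ([lt_card]). *)
Lemma regrow_no_twins (T : finType) (e : rel T) r le u w :
  symmetric e -> irreflexive e -> connected_graph e -> claw_free e ->
  normal_tree e r setT le -> twins e le u w ->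
  exists r' le', normal_tree e r' setT le' /\
    forall x y, ~~ twins e le' x y.
Proof.
move=> e_sym e_irr conn cf nt /twinsP[uw adj eqD].
have adju := ancestors_adjacent e_sym e_irr cf nt uw adj.
have adjw a : lt le a u -> e a w by move=> au; rewrite -adj ?adju.
have [le' nt' [down tot]] := reroot_spine e_sym e_irr conn nt adju.
have /andP[nuw nwu] := siblings_incomparable nt uw.
have ru := root_lt_siblings nt uw.
have rfl a : le a a by apply: (nt_refl nt); rewrite inE.
have rfl' a : le' a a by apply: (nt_refl nt'); rewrite inE.
have e_neq a b : e a b -> a != b by apply: contraTneq => ->; rewrite e_irr.
have comp' a b : e a b -> le' a b || le' b a.
  exact: (nt_edge nt' (in_setT a) (in_setT b)).
have comp a b : e a b -> le a b || le b a.
  exact: (nt_edge nt (in_setT a) (in_setT b)).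
have below_u y : ~~ le y u -> e u y -> lt le u y.
  move=> yu uy; rewrite /lt e_neq // andbT.
  by case/orP: (comp _ _ uy) yu => // ->.
have w_notin a : le w a -> ~~ le a u.
  by move=> wa; apply: contra nwu; apply: (nt_trans nt).
have smallD y : ~~ le y u -> lt le u y ->
    subtree le' y \subset subtree le u :\ u.
  move=> yu uy; apply/subsetP => z; rewrite !inE => yz.
  suff [_] : ~~ le z u /\ lt le u z by case/andP=> -> /[1!eq_sym] ->.
  pose P z := ~~ le z u /\ lt le u z.
  apply: (descend_ind (P := P) e_irr nt' _ yz _) => //.
  move=> a c ac le'ac _ [au /andP[lua _]].
  have cu : ~~ le c u by apply: contra au; apply: down.
  split=> //; rewrite /lt.
  have -> : u != c by apply: contraNneq cu => <-.
  have /orP[lac|lca] := comp _ _ ac; first by rewrite (nt_trans nt lua lac).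
  by have := nt_chain nt lca lua; rewrite (negPf cu) /= => ->.
have bigD x : lt le x u -> x |: subtree le w \subset subtree le' x.
  move=> xu; have [lxu _] := andP xu.
  have step a c : le' x a -> e a c -> ~~ le c u -> le' x c.
    move=> xa ac cu.
    have /orP[|ca] := comp' _ _ ac; first exact: (nt_trans nt').
    have /orP[//|cx] := nt_chain nt' xa ca.
    by rewrite (down _ _ cx lxu) in cu.
  apply/subsetP => z; rewrite !inE => /predU1P[->//|wz].
  suff [] : le w z /\ le' x z by [].
  apply: (descend_ind (P := fun z => le w z /\ le' x z) e_irr nt _ wz _).
    move=> a c ac lac _ [wa xa]; have wc := nt_trans nt wa lac.
    by split=> //; apply: step xa ac (w_notin c wc).
  by split=> //; apply: step (rfl' x) (adjw _ xu) nwu.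
have lt_card x y : lt le x u -> ~~ le y u -> e u y ->
    #|subtree le' y| < #|subtree le' x|.
  move=> xu yu uy; have uD : u \in subtree le u by rewrite inE.
  apply: leq_ltn_trans (subset_leq_card (smallD y yu (below_u _ yu uy))) _.
  apply: leq_trans (subset_leq_card (bigD x xu)).
  rewrite cardsU1 inE -eqD (cardsD1 u (subtree le u)) uD.
  have [wx|_] := boolP (le w x); last by rewrite !add1n ltnS.
  by have /negP[] := w_notin _ wx; case/andP: xu.
exists u, le'; split=> // x y; apply/negP => /twinsP[xy adj' eqD'].
have /siblingsP[_ anc] := xy.
have adjx := ancestors_adjacent e_sym e_irr cf nt' xy adj'.
have adjy a : lt le' a x -> e a y by move=> ax; rewrite -adj' ?adjx.
have incxy := siblings_incomparable nt' xy; have /andP[nxy nyx] := incxy.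
have ux := root_lt_siblings nt' xy.
have /andP[_ neqx] := ux; have := ux; rewrite anc => /andP[_ neqy].
have [eux euy] := conj (adjx _ ux) (adjy _ ux).
have ltu a : le a u -> u != a -> lt le a u by rewrite /lt eq_sym => ->.
have [xu|xu] := boolP (le x u); have [yu|yu] := boolP (le y u).
- by have := tot _ _ xu yu; rewrite (negPf nxy) (negPf nyx).
- by have := lt_card _ _ (ltu _ xu neqx) yu euy; rewrite eqD' ltnn.
- by have := lt_card _ _ (ltu _ yu neqy) xu eux; rewrite eqD' ltnn.
have nadj' a b : incomparable le' a b -> (a != b) && ~~ e a b.
  exact: incomparable_nonadjacent nt'.
have /andP[neqxy naxy] := nadj' _ _ incxy.
(* Now [x] and [y] are off the path, hence in the old subtree of [u]. *)
have [rx|rx] := boolP (lt le' r x).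
  (* The claw is [r] with [x], [y], [w]. *)
  have below_w z : ~~ le z u -> e u z -> (z != w) && ~~ e z w.
    move=> zu uz; apply: (incomparable_nonadjacent nt).
    have /andP[luz _] := below_u _ zu uz; apply/andP; split.
      by apply: contra nuw => /(nt_trans nt luz).
    apply/negP => wz; have := nt_chain nt luz wz.
    by rewrite (negPf nuw) (negPf nwu).
  have /andP[neqxw naxw] := below_w _ xu eux.
  have /andP[neqyw nayw] := below_w _ yu euy.
  have := claw_free_nbrs e_sym e_irr cf (adjx _ rx) (adjy _ rx) (adjw _ ru).
  by rewrite (negPf naxy) (negPf naxw) (negPf nayw) => /(_ neqxy neqxw neqyw).
(* The claw is [u] with [r], [x], [y]. *)
have inc_r z : ~~ le z u -> ~~ lt le' r z -> (r != z) && ~~ e r z.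
  move=> zu rz; apply: nadj'; apply/andP; split.
    apply: contra rz => rz; rewrite /lt rz.
    by apply: contraNneq zu => <-; case/andP: ru.
  by apply: contra zu => /down; apply; case/andP: ru.
have /andP[neqrx narx] := inc_r _ xu rx.
have /andP[neqry nary] : (r != y) && ~~ e r y by apply: inc_r; rewrite -?anc.
have eur : e u r by rewrite e_sym adju.
have := claw_free_nbrs e_sym e_irr cf eur eux euy neqrx neqry neqxy.
by rewrite (negPf narx) (negPf nary) (negPf naxy).
Qed.

Lemma exists_tree_no_twins (T : finType) (e : rel T) (r : T) :
  symmetric e -> irreflexive e -> connected_graph e -> claw_free e ->
  exists r' le, normal_tree e r' setT le /\
    forall x y, ~~ twins e le x y.
Proof.
move=> e_sym e_irr conn cf.
have nt1 : normal_tree e r [set r]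
    (fun a b => [&& a \in [set r], b \in [set r] & a == b]).
  apply: normal_tree_chain; rewrite ?set11 //.
  - by move=> a b /andP[/eqP].
  - by move=> b a c /eqP->.
  - by move=> a b /set1P-> /set1P->; rewrite eqxx.
  - by move=> a /set1P->.
  - by move=> a b /set1P-> /set1P->; rewrite /lt eqxx.
have [le nt _] := normal_tree_span e_sym e_irr conn nt1.
have [/existsP[u /existsP[w uw]]|no] :=
  boolP [exists u, exists w, twins e le u w].
  exact: (regrow_no_twins e_sym e_irr conn cf nt uw).
exists r, le; split=> // x y; apply: contra no => xy.
by apply/existsP; exists x; apply/existsP; exists y.
Qed.

Theorem theorem15 (T : finType) (e : rel T)
    (e_sym : symmetric e) (e_irr : irreflexive e)
    (e_conn : connected_graph e) (e_claw_free : claw_free e)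
    (order_ge6 : 6 <= #|T|) :
  min_oriented_distinguishing_index_is e 1.
Proof.
have /card_gt0P[r _] : 0 < #|T| by apply: leq_trans order_ge6.
have [r' [le [nt no_twins]]] :=
  exists_tree_no_twins r e_sym e_irr e_conn e_claw_free.
split; last by move=> j [d _ [[]]].
exists (downward e le); first exact: (downward_orientation e_sym e_irr nt).
split; last by move=> j [].
split=> //; exists (fun _ _ => ord0) => s aut _.
exact: (rigid_of_no_twins e_irr nt no_twins aut).
Qed.
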